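(* Let $p\ge 1$, $k\in\{0,\ldots,p\}$, and let $\Pi = (\{1,\ldots,k\},\{k+1,\ldots,p\})$. Let $S$ be a scalarization for $\Pi$ and let $$\alpha := \sup_{y' \in \mathbb{R}^p_>} \ \inf_{s \in S}\ \sup\left\{\max \left\{ \frac{y_1}{y'_1}, \ldots, \frac{y_k}{y'_k}, \frac{y'_{k+1}}{y_{k+1}},\ldots,\frac{y'_{p}}{y_{p}} \right\} \ \middle|\ y \in L(y',s)\right\}.$$ If $\alpha < \infty$, then, in each instance of each $p$-objective optimization problem of type $\Pi$, every optimal solution set for $S$ is an $(\alpha + \varepsilon)$-approximation set for any $\varepsilon > 0$. If, additionally, the infimum $$\inf_{s \in S}\ \sup\left\{\max \left\{ \frac{y_1}{y'_1}, \ldots, \frac{y_k}{y'_k}, \frac{y'_{k+1}}{y_{k+1}},\ldots,\frac{y'_{p}}{y_{p}} \right\} \ \middle|\ y \in L(y',s)\right\}$$ is attained and finite for each $y' \in \mathbb{R}^p_>$, then, in each instance of each $p$-objective optimization problem of type $\Pi$, every optimal solution set for $S$ is an $\alpha$-approximation set.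
   Context: $\mathbb{R}^p_> = \{y \in \mathbb{R}^p : y_i > 0 \text{ for } i=1,\ldots,p\}$. $\Pi = (\{1,\ldots,k\},\{k+1,\ldots,p\})$ means that objectives $1,\ldots,k$ are to be minimized and objectives $k+1,\ldots,p$ are to be maximized. For $y,y'\in\mathbb{R}^p$, $y <_\Pi y'$ means $y_i < y'_i$ for $i=1,\ldots,k$ and $y_i > y'_i$ for $i=k+1,\ldots,p$. A $p$-objective optimization problem of type $\Pi$ is a set of instances; each instance $(X,f)$ consists of a set $X$ of feasible solutions and a vector $f=(f_1,\ldots,f_p)$ of objective functions on $X$. Standing assumption: in every instance, $f(X)$ is a compact subset of $\mathbb{R}^p_>$. For $\beta\ge 1$, $x\in X$ $\beta$-approximates $x' \in X$ if $f_i(x) \le \beta f_i(x')$ for $i=1,\ldots,k$ and $f_i(x) \ge \frac1\beta f_i(x')$ for $i=k+1,\ldots,p$. A set $P\subseteq X$ is a $\beta$-approximation set if every $x'\in X$ is $\beta$-approximated by some $x\in P$. A scalarizing function for $\Pi$ is a continuous function $s:\mathbb{R}^p_>\to\mathbb{R}$ such that $y <_\Pi y'$ for $y,y'\in\mathbb{R}^p_>$ implies $s(y)<s(y')$. A scalarization for $\Pi$ is a set of scalarizing functions for $\Pi$. The level set of $s$ at $y'\in\mathbb{R}^p_>$ is $L(y',s)=\{y\in\mathbb{R}^p_> : s(y)=s(y')\}$. In an instance $(X,f)$, $x\in X$ is optimal for $s$ if $s(f(x))\le s(f(x'))$ for all $x'\in X$. A set $P \subseteq X$ is an optimal solution set for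 $S$ if for each $s\in S$ there is some $x\in P$ that is optimal for $s$. Suprema and infima are taken in $[1,\infty]$, with the infimum over the empty set equal to $\infty$. *)

(* Defs.v *)
From HB Require Import structures.
From mathcomp Require Import all_boot all_order all_algebra.
From mathcomp Require Import all_classical all_reals all_analysis.

Set Implicit Arguments.
Unset Strict Implicit.
Unset Printing Implicit Defensive.

Import Order.TTheory GRing.Theory Num.Theory.
Import numFieldNormedType.Exports.

Local Open Scope classical_set_scope.
Local Open Scope ring_scope.

(* Objectives are indexed by ['I_p], i.e. from 0: the type
   Pi = ({1..k}, {k+1..p}) is given by [k], objective [i] being minimized when
   [i < k] and maximized otherwise. *)

Definition pos_orthant (R : realType) (p : nat) : set 'rV[R]_p :=
  [set y | forall i, 0 < y 0 i].

Definition lt_Pi (R : realType) (p k : nat) (y y' : 'rV[R]_p) : Prop :=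
  forall i : 'I_p, if (i < k)%N then y 0 i < y' 0 i else y' 0 i < y 0 i.

Record instance (R : realType) (p : nat) := Instance {
  feasible : Type;
  objective : feasible -> 'rV[R]_p;
  objective_compact : compact (range objective);
  objective_pos : range objective `<=` @pos_orthant R p
}.

Definition problem (R : realType) (p : nat) := set (instance R p).

Definition approximates (R : realType) (p k : nat) (I : instance R p)
    (beta : R) (x x' : feasible I) : Prop :=
  forall i : 'I_p,
    if (i < k)%N then objective x 0 i <= beta * objective x' 0 i
    else beta^-1 * objective x' 0 i <= objective x 0 i.

Definition approximation_set (R : realType) (p k : nat) (I : instance R p)
    (beta : R) (P : set (feasible I)) : Prop :=
  forall x' : feasible I, exists2 x, P x & approximates k beta x x'.

(* A function on the positive orthant is represented by a total function
   whose values outside the orthant are never used. *)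
Definition scalarizing (R : realType) (p k : nat) (s : 'rV[R]_p -> R) : Prop :=
  {within @pos_orthant R p, continuous s} /\
  (forall y y', pos_orthant y -> pos_orthant y' -> lt_Pi k y y' -> s y < s y').

Definition scalarization (R : realType) (p k : nat)
    (S : set ('rV[R]_p -> R)) : Prop :=
  forall s, S s -> scalarizing k s.

Definition level_set (R : realType) (p : nat) (y' : 'rV[R]_p)
    (s : 'rV[R]_p -> R) : set 'rV[R]_p :=
  [set y | pos_orthant y /\ s y = s y'].

Definition optimal (R : realType) (p : nat) (I : instance R p)
    (s : 'rV[R]_p -> R) (x : feasible I) : Prop :=
  forall x' : feasible I, s (objective x) <= s (objective x').

Definition optimal_solution_set (R : realType) (p : nat) (I : instance R p)
    (S : set ('rV[R]_p -> R)) (P : set (feasible I)) : Prop :=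
  forall s, S s -> exists2 x, P x & optimal s x.

(* [-oo] is only the neutral element of [maxe]: for [0 < p] this is the maximum
   of the [p] ratios. *)
Definition max_ratio (R : realType) (p k : nat) (y y' : 'rV[R]_p) : \bar R :=
  \big[maxe/-oo%E]_(i < p)
    (if (i < k)%N then y 0 i / y' 0 i else y' 0 i / y 0 i)%:E.

(* Suprema and infima below are taken in [\bar R].  For [0 < p], [S] a
   scalarization and [y'] positive, they agree with those in [1, +oo]:
   [y'] itself lies in its level set, so every supremum is at least 1, and
   [ereal_inf set0 = +oo]. *)
Definition level_sup (R : realType) (p k : nat) (y' : 'rV[R]_p)
    (s : 'rV[R]_p -> R) : \bar R :=
  ereal_sup [set max_ratio k y y' | y in level_set y' s].

Definition level_inf (R : realType) (p k : nat) (S : set ('rV[R]_p -> R))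
    (y' : 'rV[R]_p) : \bar R :=
  ereal_inf [set level_sup k y' s | s in S].

Definition approx_factor (R : realType) (p k : nat)
    (S : set ('rV[R]_p -> R)) : \bar R :=
  ereal_sup [set level_inf k S y' | y' in @pos_orthant R p].

(* Main.v *)
Require Import Defs.
From HB Require Import structures.
From mathcomp Require Import all_boot all_order all_algebra.
From mathcomp Require Import all_classical all_reals all_analysis.
From mathcomp Require Import ring lra.

Set Implicit Arguments.
Unset Strict Implicit.
Unset Printing Implicit Defensive.

Import Order.TTheory GRing.Theory Num.Theory.
Import numFieldNormedType.Exports.

Local Open Scope classical_set_scope.
Local Open Scope ring_scope.

(** Let [x] be optimal for [s] and [x'] any feasible solution, with images [y] and [y'], so
    [s y <= s y']. Although [y] need not lie in the level set of [s] at [y'], worsening all its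
    objectives continuously reaches a point [z] of that level set ([level_set_above]). Each ratio
    that measures how well [y] approximates [y'] is at most the same ratio for [z], hence at most
    [level_sup k y' s] ([optimal_approximates]). It remains to choose [s], depending on [y'], with
    this supremum below [alpha + eps], or at most [alpha] when the infimum is attained. *)

(* Along the segment from [y] to a point [w] that is [Pi]-larger than [y'], the
   value of [s] passes from at most [s y'] to above it. *)
Lemma level_set_above (R : realType) (p k : nat) (s : 'rV[R]_p -> R)
    (y y' : 'rV[R]_p) :
  scalarizing k s -> pos_orthant y -> pos_orthant y' -> s y <= s y' ->
  exists2 z, level_set y' s z &
    forall i : 'I_p, if (i < k)%N then y 0 i <= z 0 i else z 0 i <= y 0 i.
Proof.
move=> [s_cont s_mono] y_pos y'_pos sy.
(* In every objective [w] is strictly worse than both [y] and [y']: worse than [y'] to force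
   [s y' < s w], worse than [y] to make the segment from [y] to [w] monotone. Halving the minimum
   keeps [w] positive. *)
pose w : 'rV[R]_p := \row_i (if (i < k)%N then y 0 i + y' 0 i
                              else Num.min (y 0 i) (y' 0 i) / 2).
have w_pos : pos_orthant w.
  move=> i; rewrite mxE; have := y_pos i; have := y'_pos i.
  by case: (i < k)%N => y'i yi; rewrite ?addr_gt0 ?divr_gt0 ?lt_min ?yi ?y'i.
have y'w : lt_Pi k y' w.
  move=> i; rewrite mxE; have := y_pos i; have := y'_pos i.
  case: (i < k)%N => y'i yi; first lra.
  have : Num.min (y 0 i) (y' 0 i) <= y' 0 i by rewrite ge_min lexx orbT.
  by lra.
pose g (t : R) : 'rV[R]_p := y + t *: (w - y).
have gE t i : g t 0 i = (1 - t) * y 0 i + t * w 0 i.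
  by rewrite /g !mxE; ring.
have g_pos t : 0 <= t <= 1 -> pos_orthant (g t).
  move=> /andP[t0 t1] i; rewrite gE; have := y_pos i; have := w_pos i.
  move=> wi yi.
  case: (ltrP 0 t) => t0'.
    by rewrite ltr_wpDl ?mulr_ge0 ?mulr_gt0 ?subr_ge0 // ltW.
  have -> : t = 0 by lra.
  by rewrite subr0 mul1r mul0r addr0.
have g_cont : continuous g.
  by move=> t; apply: cvgD; [exact: cvg_cst | exact: cvgZr_tmp].
(* Since [s] is continuous only within the orthant, the composition needs the whole segment to stay
   there, which is [g_pos]. *)
have sg_cont : {within `[0, 1], continuous (s \o g)}.
  apply/subspace_continuousP => t; rewrite /= in_itv /= => t01.
  move/subspace_continuousP : s_cont => /(_ _ (g_pos t t01)) s_cont.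
  apply: cvg_comp s_cont => A; rewrite /within /= => gA.
  have := g_cont t _ gA; rewrite /nbhs /= => H.
  near=> u; rewrite /= in_itv /= => u01.
  apply: (near H u) => //; exact: g_pos.
have g0 : g 0 = y by rewrite /g scale0r addr0.
have g1 : g 1 = w by rewrite /g scale1r addrC subrK.
have [| t] := @IVT _ (s \o g) 0 1 (s y') ler01 sg_cont.
  have sw := s_mono _ _ y'_pos w_pos y'w.
  by rewrite /= g0 g1 ge_min le_max sy (ltW sw) orbT.
rewrite in_itv /= => t01 sgt.
exists (g t); first by split => //; exact: g_pos.
move=> i; rewrite gE mxE; have := y_pos i; have := y'_pos i.
move: t01 => /andP[t0 t1]; case: (i < k)%N => y'i yi; first nra.
have : Num.min (y 0 i) (y' 0 i) <= y 0 i by rewrite ge_min lexx.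
by nra.
Unshelve. all: by end_near. Qed.

Lemma max_ratio_ge (R : realType) (p k : nat) (y y' : 'rV[R]_p) (i : 'I_p) :
  ((if (i < k)%N then y 0 i / y' 0 i else y' 0 i / y 0 i)%:E
    <= max_ratio k y y')%E.
Proof. by rewrite /max_ratio (bigD1 i) //= le_max lexx. Qed.

(** The point [y'] lies in its own level set, where all ratios equal 1; [0 < p] provides at least
    one ratio. This bound later excludes the value [-oo] for [alpha]. *)
Lemma level_sup_ge1 (R : realType) (p k : nat) (s : 'rV[R]_p -> R)
    (y' : 'rV[R]_p) :
  (0 < p)%N -> pos_orthant y' -> (1 <= level_sup k y' s)%E.
Proof.
move=> p_gt0 y'_pos; apply: le_ereal_sup_tmp; exists (max_ratio k y' y').
  by exists y'.
have := max_ratio_ge k y' y' (Ordinal p_gt0).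
by rewrite if_same divff // gt_eqF.
Qed.

Lemma level_inf_ge1 (R : realType) (p k : nat) (S : set ('rV[R]_p -> R))
    (y' : 'rV[R]_p) :
  (0 < p)%N -> pos_orthant y' -> (1 <= level_inf k S y')%E.
Proof.
by move=> p_gt0 y'_pos; apply: le_ereal_inf_tmp => _ [s _ <-]; exact: level_sup_ge1.
Qed.

Lemma level_inf_le_approx_factor (R : realType) (p k : nat)
    (S : set ('rV[R]_p -> R)) (y' : 'rV[R]_p) :
  pos_orthant y' -> (level_inf k S y' <= approx_factor k S)%E.
Proof. by move=> y'_pos; apply: ereal_sup_ubound; exists y'. Qed.

Lemma optimal_approximates (R : realType) (p k : nat) (I : instance R p)
    (s : 'rV[R]_p -> R) (beta : R) (x x' : feasible I) :
  scalarizing k s -> optimal s x ->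
  (level_sup k (objective x') s <= beta%:E)%E -> approximates k beta x x'.
Proof.
move=> s_scal x_opt sup_le.
have y_pos (u : feasible I) : pos_orthant (objective u).
  by apply: objective_pos; exists u.
have [z z_lvl yz] := level_set_above s_scal (y_pos x) (y_pos x') (x_opt x').
have z_le i := le_trans (max_ratio_ge k z (objective x') i)
  (le_trans (ereal_sup_ubound (imageP (max_ratio k ^~ _) z_lvl)) sup_le).
move=> i; move: (yz i) (z_le i) (y_pos x i) (y_pos x' i) (z_lvl.1 i).
case: (i < k)%N => yzi; rewrite lee_fin => le_beta yi y'i zi.
  by rewrite (le_trans yzi) // -ler_pdivrMr.
(* The maximized case divides by [beta]; its sign comes from the positive ratio that [beta]
   bounds. *)
have beta_gt0 : 0 < beta by rewrite (lt_le_trans _ le_beta) // divr_gt0.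
by rewrite mulrC ler_pdivrMr // (le_trans _ (ler_wpM2r (ltW beta_gt0) yzi)) //
  mulrC -ler_pdivrMr.
Qed.

Theorem theorem4p4 (R : realType) (p k : nat) (hp : (1 <= p)%N) (hk : (k <= p)%N)
    (S : set ('rV[R]_p -> R)) (hS : scalarization k S)
    (alpha_fin : (approx_factor k S < +oo)%E) :
  (forall (Q : problem R p) (I : instance R p), Q I ->
     forall P : set (feasible I), optimal_solution_set S P ->
     forall eps : R, 0 < eps ->
     approximation_set k (fine (approx_factor k S) + eps) P)
  /\
  ((forall y' : 'rV[R]_p, pos_orthant y' ->
      (exists2 s, S s & level_sup k y' s = level_inf k S y') /\
      level_inf k S y' \is a fin_num) ->
   forall (Q : problem R p) (I : instance R p), Q I ->
     forall P : set (feasible I), optimal_solution_set S P ->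
     approximation_set k (fine (approx_factor k S)) P).
Proof.
have y_pos (I : instance R p) (u : feasible I) : pos_orthant (objective u).
  by apply: objective_pos; exists u.
have alphaE (y' : 'rV[R]_p) : pos_orthant y' ->
    (fine (approx_factor k S))%:E = approx_factor k S.
  (* [fine] sends infinite values to 0, so both must be excluded: [+oo] by assumption, [-oo] by the
     lower bound 1 at [y']. *)
  move=> y'_pos; rewrite fineK // ge0_fin_numE //.
  apply: le_trans (level_inf_le_approx_factor k S y'_pos).
  by apply: le_trans (level_inf_ge1 k S hp y'_pos); rewrite lee_fin.
split=> [Q I _ P P_opt eps eps_gt0 x' | attained Q I _ P P_opt x'].
  have inf_lt : (level_inf k S (objective x') <
                 (fine (approx_factor k S) + eps)%:E)%E.
    rewrite (le_lt_trans (level_inf_le_approx_factor k S (y_pos I x'))) //.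
    by rewrite -(alphaE _ (y_pos I x')) lte_fin ltrDl.
  (* The slack [eps] makes the inequality strict, so some [s] in [S] satisfies it even if the
     infimum is not attained. *)
  have [_ [s Ss <-] sup_lt] := ereal_inf_lt inf_lt.
  have [x Px x_opt] := P_opt s Ss.
  by exists x => //; apply: optimal_approximates (hS _ Ss) x_opt (ltW sup_lt).
have [[s Ss sup_eq] _] := attained _ (y_pos I x').
have [x Px x_opt] := P_opt s Ss.
exists x => //; apply: optimal_approximates (hS _ Ss) x_opt _.
by rewrite sup_eq (alphaE _ (y_pos I x')) level_inf_le_approx_factor.
Qed.
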